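(* Let $1 < p \in \mathbb{R}$ and let $G$ be a finitely generated, infinite group. Then $\bar{H}^1_{(p)}(G) \neq 0$ if and only if $\#(\partial_p(G)) > 1$, where $\bar{H}^1_{(p)}(G)$ is the first reduced $\ell^p$-cohomology space of $G$ and $\partial_p(G)$ is the $p$-harmonic boundary of $G$.
   Context: Let $G$ be a finitely generated group with identity $e_G$ and finite symmetric generating set $S$. $\mathcal{F}(G)$ is the set of all complex-valued functions on $G$. $D_p(G)=\{f\in\mathcal{F}(G) : \sum_{g\in G}|f(gs^{-1})-f(g)|^p<\infty \text{ for all } s\in S\}$, with pseudonorm $\|f\|=\left(\sum_{s\in S}\sum_{g\in G}|f(gs^{-1})-f(g)|^p\right)^{1/p}$ and Banach norm $\|f\|_{D_p}=(\|f\|^p+|f(e_G)|^p)^{1/p}$. For $A\subseteq D_p(G)$, $(\overline{A})_{D_p}$ denotes the closure of $A$ in $D_p(G)$ for $\|\cdot\|_{D_p}$. $\mathbb{C}$ is identified with the constant functions. $\ell^p(G)$ is the set of $p$-summable functions on $G$; $\mathbb{C}G$ is the set of finitely supported functions on $G$. The first reduced $\ell^p$-cohomology space is $\bar{H}^1_{(p)}(G)=D_p(G)/(\overline{\ell^p(G)\oplus\mathbb{C}})_{D_p}$. $BD_p(G)$ is the set of bounded functions in $D_p(G)$; it is a commutative Banach algebra under pointwise operations with norm $\|f\|_{BD_p}=\|f\|_\infty+\|f\|$. $Sp(BD_p(G))$ is the set of characters (nonzero algebra homomorphisms $BD_p(G)\to\mathbb{C}$), with the weak-$*$ topology; it is a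 compact Hausdorff space. For $f\in BD_p(G)$, $\hat f(\tau)=\tau(f)$ for $\tau \in Sp(BD_p(G))$. $G$ is identified with its image under the injection $i:G\to Sp(BD_p(G))$, $(i(g))(f)=f(g)$. $B(\overline{\mathbb{C}G})_{D_p}$ is the set of bounded functions in $(\overline{\mathbb{C}G})_{D_p}$. The $p$-harmonic boundary is $\partial_p(G)=\{x\in Sp(BD_p(G))\setminus G : \hat f(x)=0 \text{ for all } f\in B(\overline{\mathbb{C}G})_{D_p}\}$. $\#(A)$ denotes the cardinality of a set $A$. *)

(* Defs.v *)
From HB Require Import structures.
From mathcomp Require Import all_boot all_order all_algebra finmap complex.
From mathcomp Require Import all_classical all_reals all_analysis.

Set Implicit Arguments.
Unset Strict Implicit.
Unset Printing Implicit Defensive.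

Import Order.TTheory GRing.Theory Num.Theory.

Local Open Scope classical_set_scope.
Local Open Scope ring_scope.

(* The R-valued modulus: the library's `|z| on R[i] takes its values in R[i]. *)
Notation cmod := (@Normc.normc _).

Section GeneratingSet.
Variables (G : groupType) (S : {fset G}).

Definition symmetric_set := forall s, s \in S -> s^-1%g \in S.

Definition generating_set :=
  forall H : {pred G}, group_closed H -> {subset S <= H} -> forall g, g \in H.

End GeneratingSet.

Section FunctionSpaces.
Variables (R : realType) (p : R) (G : groupType) (S : {fset G}).
Local Notation C := R[i].
Implicit Types (f g h : G -> C) (A : set (G -> C)).

Definition diffsum f (s : G) : \bar R :=
  \esum_(x in [set: G]) (cmod (f (x * s^-1)%g - f x) `^ p)%:E.

Definition Dp : set (G -> C) :=
  [set f | forall s, s \in S -> (diffsum f s < +oo)%E].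

Definition Dp_seminorm f : R := (\sum_(s <- S) fine (diffsum f s)) `^ p^-1.

Definition Dp_norm f : R :=
  (Dp_seminorm f `^ p + cmod (f 1%g) `^ p) `^ p^-1.

Definition Dp_closure A : set (G -> C) :=
  [set f | Dp f /\ forall e : R, 0 < e -> exists2 a, A a & Dp_norm (f - a) < e].

Definition lp : set (G -> C) :=
  [set f | (\esum_(x in [set: G]) (cmod (f x) `^ p)%:E < +oo)%E].

Definition finitely_supported : set (G -> C) :=
  [set f | finite_set [set x | f x != 0]].

Definition lp_plus_constants : set (G -> C) :=
  [set f | exists h (c : C), lp h /\ f = h + cst c].

Definition affine_coset (N : set (G -> C)) f : set (G -> C) := [set f + h | h in N].

(* The quotient space, as its set of cosets. *)
Definition reduced_H1 : set (set (G -> C)) :=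
  affine_coset (Dp_closure lp_plus_constants) @` Dp.

Definition reduced_H1_zero : set (G -> C) :=
  affine_coset (Dp_closure lp_plus_constants) 0.

Definition bounded_function f := exists M : R, forall x, cmod (f x) <= M.

Definition BDp_pred : {pred (G -> C)} :=
  [pred f | `[< Dp f /\ bounded_function f >]].

Lemma esum_dominated (C0 : R) (a b : G -> R) : (forall x, 0 <= b x) ->
  (forall x, a x <= C0 * b x) -> 0 <= C0 ->
  (\esum_(x in [set: G]) (b x)%:E < +oo)%E ->
  (\esum_(x in [set: G]) (a x)%:E < +oo)%E.
Proof.
move=> b0 ab C00 boo.
apply: (@le_lt_trans _ _ (C0%:E * \esum_(x in [set: G]) (b x)%:E)%E); last first.
  have bfin : (\esum_(x in [set: G]) (b x)%:E)%E \is a fin_num.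
    by rewrite ge0_fin_numE// esum_ge0// => g _; rewrite lee_fin.
  by rewrite -(fineK bfin) -EFinM ltry.
apply: ge_ereal_sup => _ [A [finA _] <-].
apply: (@le_trans _ _ (\sum_(x \in A) (C0%:E * (b x)%:E))%E).
  by apply: lee_fsum => // g _; rewrite -EFinM lee_fin.
rewrite -ge0_mule_fsumr; last by move=> g; rewrite lee_fin.
apply: lee_wpmul2l; first by rewrite lee_fin.
by apply: esum_ge; exists A.
Qed.

Lemma cmod_ge0 (z : C) : 0 <= cmod z.
Proof. by case: z => x y /=; exact: sqrtr_ge0. Qed.

Lemma powR_comb (x y z k l : R) : 0 <= p -> 0 <= x -> 0 <= y -> 0 <= k ->
  0 <= l -> 0 <= z -> z <= k * x + l * y ->
  z `^ p <= (2 * Num.max k l) `^ p * (x `^ p + y `^ p).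
Proof.
move=> p0 x0 y0 k0 l0 z0 zle.
have m0 : 0 <= Num.max k l by rewrite le_max k0.
have t0 : 0 <= Num.max x y by rewrite le_max x0.
have zle2 : z <= 2 * Num.max k l * Num.max x y.
  apply: (le_trans zle).
  rewrite -mulrA mulr_natl mulr2n.
  by apply: lerD; apply: ler_pM => //; rewrite le_max lexx ?orbT.
apply: (@le_trans _ _ ((2 * Num.max k l * Num.max x y) `^ p)).
  by apply: ge0_ler_powR; rewrite ?nnegrE ?mulr_ge0.
rewrite powRM ?mulr_ge0//; apply: ler_wpM2l; first exact: powR_ge0.
by case: (leP x y) => _; rewrite ?lerDl ?lerDr powR_ge0.
Qed.

Lemma diffsum_comb (k l : R) f g h s : 0 <= p -> 0 <= k -> 0 <= l ->
  (forall x y, cmod (f x - f y) <= k * cmod (g x - g y) + l * cmod (h x - h y)) ->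
  (diffsum g s < +oo)%E -> (diffsum h s < +oo)%E -> (diffsum f s < +oo)%E.
Proof.
move=> p0 k0 l0 fgh gs hs.
apply: (@esum_dominated ((2 * Num.max k l) `^ p) _
  (fun x => cmod (g (x * s^-1)%g - g x) `^ p + cmod (h (x * s^-1)%g - h x) `^ p)).
- by move=> x; rewrite addr_ge0 ?powR_ge0.
- by move=> x; apply: powR_comb => //; exact: cmod_ge0.
- exact: powR_ge0.
- under eq_esum do rewrite EFinD.
  rewrite esumD; first exact: lte_add_pinfty.
  + by move=> x _; rewrite lee_fin powR_ge0.
  + by move=> x _; rewrite lee_fin powR_ge0.
Qed.

Lemma diffsum_cst (c : C) s : 1 < p -> diffsum (cst c) s = 0%E.
Proof.
move=> p1; apply: esum1 => g _.
by rewrite /cst subrr Normc.normc0 powR0// gt_eqF// (lt_trans ltr01).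
Qed.

Lemma BDp_1 : 1 < p -> 1 \in BDp_pred.
Proof.
move=> p1; rewrite inE; split; last first.
  by exists 1 => g; rewrite Normc.normc1.
by move=> s _; rewrite [diffsum _ _]diffsum_cst// ltry.
Qed.

Lemma BDp_linear : 1 < p -> linear_closed BDp_pred.
Proof.
move=> p1 a f g; rewrite !inE => -[Df [Mf bf]] [Dg [Mg bg]].
have p0 : 0 <= p by rewrite (le_trans ler01)// ltW.
split; last first.
  exists (cmod a * Mf + Mg) => x; apply: (le_trans (le_normcD _ _)).
  apply: lerD => //.
  by rewrite [a *: f]/GRing.scale/= [a *: _]/GRing.scale/= Normc.normcM ler_wpM2l// cmod_ge0.
move=> s sS; apply: (@diffsum_comb (cmod a) 1 _ f g) => //.
- exact: cmod_ge0.
- move=> x y.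
  have -> : (a *: f + g) x - (a *: f + g) y = a * (f x - f y) + (g x - g y).
    by rewrite /= mulrBr addrACA -opprD.
  by apply: (le_trans (le_normcD _ _)); rewrite Normc.normcM mul1r.
- exact: Df.
- exact: Dg.
Qed.

Lemma BDp_mul : 1 < p -> {in BDp_pred &, forall f g, f * g \in BDp_pred}.
Proof.
move=> p1 f g; rewrite !inE => -[Df [Mf bf]] [Dg [Mg bg]].
have p0 : 0 <= p by rewrite (le_trans ler01)// ltW.
have Mf0 : 0 <= Mf by apply: le_trans (bf 1%g); exact: cmod_ge0.
have Mg0 : 0 <= Mg by apply: le_trans (bg 1%g); exact: cmod_ge0.
split; last first.
  by exists (Mf * Mg) => x; rewrite Normc.normcM; apply: ler_pM => //; exact: cmod_ge0.
move=> s sS; apply: (@diffsum_comb Mg Mf _ f g) => //.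
- move=> x y.
  have -> : (f * g) x - (f * g) y = (f x - f y) * g x + f y * (g x - g y).
    by rewrite /= mulrBl mulrBr addrA subrK.
  apply: (le_trans (le_normcD _ _)).
  rewrite !Normc.normcM [X in X + _]mulrC.
  by apply: lerD; apply: ler_wpM2r => //; exact: cmod_ge0.
- exact: Df.
- exact: Dg.
Qed.

End FunctionSpaces.

(* The proof of 1 < p is a phantom parameter: it lets the algebra structure be *)
(* inferred.                                                                   *)
Definition BDp (R : realType) (p : R) (G : groupType) (S : {fset G})
    of 1 < p : Type := {f : G -> R[i] | f \in BDp_pred p S}.

Section BDpAlgebra.
Variables (R : realType) (p : R) (G : groupType) (S : {fset G}) (p1 : 1 < p).
Local Notation C := R[i].
Local Notation BD := (BDp S p1).

HB.instance Definition _ := [isSub of BD for @proj1_sig _ _].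
HB.instance Definition _ := [Choice of BD by <:].

Fact BDp_submod : GRing.submod_closed (BDp_pred p S).
Proof.
split; last exact: BDp_linear.
have := BDp_linear p1 (-1) (BDp_1 S p1) (BDp_1 S p1).
by rewrite scaleN1r addNr.
Qed.

HB.instance Definition _ := GRing.SubChoice_isSubLmodule.Build C (G -> C)
  (BDp_pred p S) BD BDp_submod.

Fact BDp_subring : subring_closed (BDp_pred p S).
Proof.
split; [exact: BDp_1 | | exact: BDp_mul].
move=> f g fB gB; rewrite addrC -scaleN1r.
exact: BDp_linear.
Qed.

HB.instance Definition _ := GRing.SubZmodule_isSubPzRing.Build (G -> C)
  (BDp_pred p S) BD BDp_subring.
HB.instance Definition _ := GRing.SubPzRing_isSubComPzRing.Build (G -> C)
  (BDp_pred p S) BD.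

Fact BDp_neq0 : 1 != 0 :> BD.
Proof.
apply/eqP => /(congr1 (fun f : BD => val f 1%g)); rewrite rmorph1 raddf0.
by move/eqP; rewrite oner_eq0.
Qed.

HB.instance Definition _ := GRing.PzSemiRing_isNonZero.Build BD BDp_neq0.

Lemma BDp_addE (f g : BD) x : val (f + g) x = val f x + val g x.
Proof. by []. Qed.

Lemma BDp_mulE (f g : BD) x : val (f * g) x = val f x * val g x.
Proof. by []. Qed.

Lemma BDp_scaleE (a : C) (f : BD) x : val (a *: f) x = a * val f x.
Proof. by []. Qed.

Fact BDp_scalerAl (a : C) (f g : BD) : a *: (f * g) = (a *: f) * g.
Proof.
apply: val_inj; apply/funext => x.
by rewrite BDp_mulE !BDp_scaleE BDp_mulE mulrA.
Qed.

HB.instance Definition _ := GRing.Lmodule_isLalgebra.Build C BD BDp_scalerAl.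
HB.instance Definition _ := GRing.Lalgebra_isComAlgebra.Build C BD.

(* Characters are not assumed to be unital. *)
Definition spectrum : set (BD -> C) :=
  [set tau | [/\ scalar tau, {morph tau : f g / f * g}
               & exists f, tau f != 0]].

Definition gelfand (f : BD) (tau : BD -> C) : C := tau f.

Definition point_evaluation (g : G) : BD -> C := fun f => val f g.

Definition harmonic_boundary : set (BD -> C) :=
  [set x | [/\ spectrum x, ~ range point_evaluation x
             & forall f : BD,
                 Dp_closure p S (@finitely_supported R G) (val f) ->
                 gelfand f x = 0]].

End BDpAlgebra.

Arguments spectrum {R p G} S p1.
Arguments harmonic_boundary {R p G} S p1.

(* Main.v *)
Require Import Defs.
From HB Require Import structures.
From mathcomp Require Import all_boot all_order all_algebra finmap complex.
From mathcomp Require Import all_classical all_reals all_analysis.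
From mathcomp Require Import ring lra.

(* Dominated convergence shows that the bounded functions I in the closure of CG
   form an ideal of BD_p which is stable under truncation, and that truncations
   approximate every function of D_p.  Hence the reduced cohomology is nonzero
   iff some f in BD_p is not in I + C.

   Let F be the filter of the sets A such that some phi in I equals 1 off A; it
   is proper as soon as 1 is not in I, and limits along an ultrafilter containing
   F are points of the harmonic boundary.  If f converged to c along F, then the
   part of f - c exceeding any epsilon in modulus would be its product with some
   phi in I, so f - c would be in I.  So when f is not in I + C there are two
   such ultrafilters with different limits of f.

   Conversely, a point of the boundary kills I and maps 1 to 1, so 1 is not in
   I; then CG + C has closure closure(CG) + C, and if that is all of D_p, the
   points of the boundary agree on BD_p. *)

Set Implicit Arguments.
Unset Strict Implicit.
Unset Printing Implicit Defensive.

Import Order.TTheory GRing.Theory Num.Theory.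
Import numFieldNormedType.Exports.

Local Open Scope classical_set_scope.
Local Open Scope ring_scope.
Local Open Scope card_scope.

(** * The complex modulus and truncation of complex numbers *)

Section ComplexModulus.
Variable R : realType.
Implicit Types (a b M : R) (z w : R[i]).

Lemma cmodN z : cmod (- z) = cmod z.
Proof. exact: normcN. Qed.

Lemma cmodB z w : cmod (z - w) = cmod (w - z).
Proof. by rewrite -opprB cmodN. Qed.

Lemma cmodD z w : cmod (z + w) <= cmod z + cmod w.
Proof. exact: le_normcD. Qed.

Lemma cmod_le z w : `|complex.Re z| <= `|complex.Re w| ->
  `|complex.Im z| <= `|complex.Im w| -> cmod z <= cmod w.
Proof.
case: z w => [a b] [c d] /= ac bd; rewrite ler_sqrt ?addr_ge0 ?sqr_ge0//.
by rewrite lerD// -real_normK ?num_real// -[leRHS]real_normK ?num_real// lerXn2r ?nnegrE.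
Qed.

Lemma cmod_Re_Im z : cmod z <= `|complex.Re z| + `|complex.Im z|.
Proof.
case: z => a b /=; rewrite -[leRHS]ger0_norm ?addr_ge0// -sqrtr_sqr.
rewrite ler_sqrt ?sqr_ge0// -(real_normK (num_real a)) -(real_normK (num_real b)).
by have := normr_ge0 a; have := normr_ge0 b; nra.
Qed.

Lemma Re_le_cmod z : `|complex.Re z| <= cmod z.
Proof.
by case: z => a b /=; rewrite -sqrtr_sqr ler_sqrt ?addr_ge0 ?sqr_ge0// lerDl sqr_ge0.
Qed.

Lemma Im_le_cmod z : `|complex.Im z| <= cmod z.
Proof.
by case: z => a b /=; rewrite -sqrtr_sqr ler_sqrt ?addr_ge0 ?sqr_ge0// lerDr sqr_ge0.
Qed.

Lemma cmod_gt0 z : z != 0 -> 0 < cmod z.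
Proof.
move=> z0; rewrite lt_neqAle cmod_ge0 andbT eq_sym.
by apply: contra z0 => /eqP/Normc.eq0_normc ->.
Qed.

Definition clamp M a : R := Num.max (- M) (Num.min M a).

Lemma clamp_lipschitz M a b : `|clamp M a - clamp M b| <= `|a - b|.
Proof.
rewrite /clamp ler_norml.
have := ler_norm (a - b); have := ler_norm (- (a - b)); rewrite normrN.
move: `|_| => d; case: (leP M a) => ?; case: (leP M b) => ?;
  case: (leP (- M) a) => ?; case: (leP (- M) b) => ?; case: (leP (- M) M) => ?;
  rewrite ?lexx => ? ?; apply/andP; split; lra.
Qed.

Lemma clamp_bound M a : 0 <= M -> `|clamp M a| <= M.
Proof.
move=> M0; rewrite /clamp ler_norml.
by case: (leP M a) => ?; case: (leP (- M) a) => ?; case: (leP (- M) M) => ?;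
  apply/andP; split; lra.
Qed.

Lemma clamp_id M a : `|a| <= M -> clamp M a = a.
Proof. by rewrite /clamp ler_norml => /andP[? ?]; rewrite min_r// max_r. Qed.

(* The rectangular truncation: unlike the radial one it is visibly 1-Lipschitz. *)
Definition ctrunc M z : R[i] :=
  Complex (clamp M (complex.Re z)) (clamp M (complex.Im z)).

Lemma ctrunc_lipschitz M z w : cmod (ctrunc M z - ctrunc M w) <= cmod (z - w).
Proof. by case: z w => [a b] [c d]; apply: cmod_le => /=; exact: clamp_lipschitz. Qed.

Lemma ctrunc_bound M z : 0 <= M -> cmod (ctrunc M z) <= M + M.
Proof. by move=> M0; apply: (le_trans (cmod_Re_Im _)); rewrite lerD//= clamp_bound. Qed.

Lemma ctrunc_id M z : cmod z <= M -> ctrunc M z = z.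
Proof.
move=> zM; rewrite /ctrunc !clamp_id; first by case: z zM.
  exact: le_trans (Im_le_cmod z) zM.
exact: le_trans (Re_le_cmod z) zM.
Qed.

Lemma ctrunc0 M : 0 <= M -> ctrunc M 0 = 0.
Proof. by move=> M0; rewrite ctrunc_id// Normc.normc0. Qed.

Lemma ctrunc_real M a : 0 <= M -> M <= a -> ctrunc M (a%:C)%C = (M%:C)%C.
Proof.
move=> M0 Ma; rewrite /ctrunc /= [clamp M 0]clamp_id ?normr0// /clamp min_l// max_r//.
by lra.
Qed.

End ComplexModulus.

(** * Limits of complex functions along filters and ultrafilters *)

Section UltrafilterLimits.
Variables (R : realType) (T : Type).
Implicit Types (U : set_system T) (f g : T -> R[i]) (z w : R[i]).

Definition ulim U f z := forall e : R, 0 < e -> U [set x | cmod (f x - z) < e].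

Lemma ulim_unique U {UF : ProperFilter U} f z w : ulim U f z -> ulim U f w -> z = w.
Proof.
move=> fz fw; apply/eqP; rewrite -subr_eq0; apply: contrapT => /negP /cmod_gt0 d0.
have d20 : 0 < cmod (z - w) / 2 by rewrite divr_gt0.
have [x [/= xz xw]] := filter_ex (filterI (fz _ d20) (fw _ d20)).
have := cmodD (z - f x) (f x - w); rewrite addrA subrK (cmodB z).
by set d := cmod (z - w) in xz xw *; lra.
Qed.

(** Real and imaginary parts take values in a segment, whose compactness gives a cluster point of
    the image of [U]; for an ultrafilter, a cluster point is a limit. *)
Lemma ulim_exists U f (M : R) : UltraFilter U -> (forall x, cmod (f x) <= M) ->
  exists z, ulim U f z.
Proof.
move=> UU fM.
have key (h : T -> R) : (forall x, `|h x| <= M) ->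
    exists a : R, forall e : R, 0 < e -> U [set x | `|h x - a| < e].
  move=> hM; have hU : U (h @^-1` `[- M, M]%classic).
    by apply: filterS (@filterT _ U _) => x _; rewrite /= in_itv/= -ler_norml; exact: hM.
  have [a [_ ah]] := @segment_compact R (- M) M (h @ U) _ hU.
  (* [U] contains this set or its complement; the complement would keep [h] away from its cluster
     point [a]. *)
  exists a => e e0; have [//|nU] := in_ultra_setVsetC [set x | `|h x - a| < e] UU.
  have [|y [hy]] := ah [set y | e <= `|y - a|] (ball a e) _ (nbhsx_ballx a e e0).
    by apply: (@filterS _ U _ _ _ _ nU) => x xe /=; rewrite leNgt; apply/negP.
  by rewrite -ball_normE/= distrC ltNge => /negP.
have [a ha] := key _ (fun x => le_trans (Re_le_cmod (f x)) (fM x)).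
have [b hb] := key _ (fun x => le_trans (Im_le_cmod (f x)) (fM x)).
exists (Complex a b) => e e0; have e20 : 0 < e / 2 by rewrite divr_gt0.
apply: filterS (filterI (ha _ e20) (hb _ e20)) => x [/= xa xb].
apply: (le_lt_trans (cmod_Re_Im _)).
by case: (f x) xa xb => c d /= *; lra.
Qed.

(** The common estimate behind limits of sums, scalar multiples and products. *)
Lemma ulim_comb U {UF : Filter U} f g h z w u (M : R) :
  (forall x, cmod (h x - u) <= M * cmod (f x - z) + M * cmod (g x - w)) ->
  ulim U f z -> ulim U g w -> ulim U h u.
Proof.
move=> hM fz gw e e0.
(* A positive bound for [M], whose sign is unknown, by which one can divide. *)
have M0 : 0 < `|M| + 1 by rewrite ltr_wpDl.
have d0 : 0 < e / (`|M| + 1) / 2 by rewrite !divr_gt0.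
apply: filterS (filterI (fz _ d0) (gw _ d0)) => x [/= xz xw].
apply: (le_lt_trans (hM x)); rewrite -mulrDr.
apply: (@le_lt_trans _ _ ((`|M| + 1) * (cmod (f x - z) + cmod (g x - w)))).
  by rewrite ler_wpM2r ?addr_ge0 ?cmod_ge0//; have := ler_norm M; lra.
rewrite -ltr_pdivlMl// mulrC; set d := e / _ in xz xw *; lra.
Qed.

Lemma ulimD U {UF : Filter U} f g z w :
  ulim U f z -> ulim U g w -> ulim U (f + g) (z + w).
Proof.
apply: (@ulim_comb _ _ _ _ _ _ _ _ 1) => x; rewrite !mul1r.
by apply: le_trans (cmodD _ _); rewrite [(f + g) x]/= opprD addrACA.
Qed.

Lemma ulimZ U {UF : Filter U} (a : R[i]) f z : ulim U f z -> ulim U (a *: f) (a * z).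
Proof.
move=> fz; apply: (@ulim_comb _ _ f f _ _ _ _ (cmod a)) (fz) (fz) => x.
by rewrite /= -mulrBr Normc.normcM lerDl mulr_ge0 ?cmod_ge0.
Qed.

Lemma ulimM U {UF : Filter U} f g z w (M : R) : (forall x, cmod (f x) <= M) ->
  ulim U f z -> ulim U g w -> ulim U (f * g) (z * w).
Proof.
move=> fM; apply: (@ulim_comb _ _ _ _ _ _ _ _ (Num.max M (cmod w))) => x.
have -> : (f * g) x - z * w = (f x - z) * w + f x * (g x - w).
  by rewrite mulrBr mulrBl [RHS]addrC addrA subrK.
apply: (le_trans (cmodD _ _)); rewrite !Normc.normcM [_ * cmod w]mulrC.
apply: lerD; rewrite ler_wpM2r ?cmod_ge0// le_max ?lexx ?orbT//.
by rewrite fM.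
Qed.

End UltrafilterLimits.

(** * Sequences tending to zero *)

Section VanishingSequences.
Variable R : realType.
Implicit Types (E F : nat -> \bar R) (z : nat -> R[i]).

(** Only an upper bound is recorded: on nonnegative sequences this is convergence to 0. *)
Definition vanishing E := forall e : R, 0 < e -> \forall n \near \oo, (E n < e%:E)%E.

Definition cvanishing z := forall e : R, 0 < e -> \forall n \near \oo, cmod (z n) < e.

Lemma vanishing_le E F : (forall n, (E n <= F n)%E) -> vanishing F -> vanishing E.
Proof. by move=> EF vF e /vF; apply: filterS => n; exact: le_lt_trans. Qed.

Lemma vanishing0 : vanishing (fun=> 0%E).
Proof. by move=> e e0; apply: filterE => n; rewrite lte_fin. Qed.

Lemma vanishingD E F : vanishing E -> vanishing F -> vanishing (fun n => E n + F n)%E.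
Proof.
move=> vE vF e e0; have e20 : 0 < e / 2 by rewrite divr_gt0.
apply: filterS (filterI (vE _ e20) (vF _ e20)) => n [En Fn].
by rewrite [e]splitr EFinD lteD.
Qed.

Lemma vanishingZ (K : R) E : (forall n, 0 <= E n)%E -> vanishing E ->
  vanishing (fun n => K%:E * E n)%E.
Proof.
move=> E0 vE e e0; have K0 : 0 < `|K| + 1 by rewrite ltr_wpDl.
apply: filterS (vE _ (divr_gt0 e0 K0)) => n En.
apply: (@le_lt_trans _ _ ((`|K| + 1)%:E * E n)%E).
  by apply: lee_wpmul2r => //; rewrite lee_fin; have := ler_norm K; lra.
by rewrite -[e](divfK (lt0r_neq0 K0)) mulrC EFinM lte_pmul2l.
Qed.

Lemma vanishing_sum (I : eqType) (s : seq I) (E : I -> nat -> \bar R) :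
  (forall i, i \in s -> vanishing (E i)) -> vanishing (fun n => \sum_(i <- s) E i n)%E.
Proof.
elim: s => [_|i s ih h].
  by apply: vanishing_le vanishing0 => n; rewrite big_nil.
apply: (@vanishing_le _ (fun n => E i n + \sum_(j <- s) E j n)%E) => [n|].
  by rewrite big_cons.
apply: vanishingD; first exact: h (mem_head _ _).
by apply: ih => j js; apply: h; rewrite in_cons js orbT.
Qed.

(** Serves limit superior arguments, in which the tail of a series is cut off at a cost of [e]. *)
Lemma vanishing_approx E : (forall e : R, 0 < e ->
    exists2 F, vanishing F & forall n, (E n <= F n + e%:E)%E) -> vanishing E.
Proof.
move=> h e e0; have e20 : 0 < e / 2 by rewrite divr_gt0.
have [F vF EF] := h _ e20; apply: filterS (vF _ e20) => n Fn.
by apply: (le_lt_trans (EF n)); rewrite [in ltRHS](splitr e) EFinD lteD2rE.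
Qed.

Lemma powR_lt_root (p a e : R) : 0 < p -> 0 <= a -> 0 < e ->
  a < e `^ p^-1 -> a `^ p < e.
Proof.
move=> p0 a0 e0 ae; rewrite -[e]powRr1 ?ltW// -(mulVf (lt0r_neq0 p0)) powRrM.
by rewrite gt0_ltr_powR// nnegrE// powR_ge0.
Qed.

Lemma vanishing_powR (p : R) z : 0 < p -> cvanishing z ->
  vanishing (fun n => (cmod (z n) `^ p)%:E).
Proof.
move=> p0 vz e e0; apply: filterS (vz _ (powR_gt0 p^-1 e0)) => n zn.
by rewrite lte_fin powR_lt_root// cmod_ge0.
Qed.

Lemma powR_vanishing (p : R) z : 0 < p ->
  vanishing (fun n => (cmod (z n) `^ p)%:E) -> cvanishing z.
Proof.
move=> p0 vz e e0; apply: filterS (vz _ (powR_gt0 p e0)) => n.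
rewrite lte_fin !ltNge; apply: contra => ez.
by apply: ge0_ler_powR ez; rewrite ?nnegrE ?cmod_ge0// ltW.
Qed.

Lemma cvanishingD (z w : nat -> R[i]) : cvanishing z -> cvanishing w ->
  cvanishing (fun n => z n + w n).
Proof.
move=> vz vw e e0; have e20 : 0 < e / 2 by rewrite divr_gt0.
apply: filterS (filterI (vz _ e20) (vw _ e20)) => n [zn wn].
by apply: (le_lt_trans (cmodD _ _)); rewrite [e]splitr ltrD.
Qed.

Lemma cvanishingN z : cvanishing z -> cvanishing (fun n => - z n).
Proof. by move=> vz e /vz; apply: filterS => n; rewrite cmodN. Qed.

End VanishingSequences.

(** * Unordered sums of nonnegative terms *)

Section Esum.
Variables (R : realType) (T : choiceType).

Lemma ge0_esumZl_le (K : R) (a : T -> \bar R) (D : set T) : 0 <= K ->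
  (forall x, 0 <= a x)%E ->
  (\esum_(x in D) (K%:E * a x) <= K%:E * \esum_(x in D) a x)%E.
Proof.
move=> K0 a0; apply: ge_ereal_sup => _ [A [finA AD] <-].
rewrite -ge0_mule_fsumr//; apply: lee_wpmul2l; first by rewrite lee_fin.
by apply: esum_ge; exists A.
Qed.

Lemma esum_term_le (a : T -> \bar R) (D : set T) x : D x ->
  (a x <= \esum_(x in D) a x)%E.
Proof.
move=> Dx; apply: esum_ge; exists [set x]; last by rewrite fsbig_set1.
by split; [exact: finite_set1|move=> _ ->].
Qed.

(** The sum is the supremum of its finite partial sums, so some finite [A] captures all but less
    than [e] of it. *)
Lemma esum_tail (a : T -> \bar R) (e : R) : (forall x, 0 <= a x)%E ->
  (\esum_(x in [set: T]) a x < +oo)%E -> 0 < e ->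
  exists2 A : set T, finite_set A & (\esum_(x in ~` A) a x < e%:E)%E.
Proof.
move=> a0 afin e0.
have aE : (\esum_(x in [set: T]) a x)%E \is a fin_num.
  by rewrite ge0_fin_numE// esum_ge0.
have [_ [A [finA _] <-]] := ub_ereal_sup_adherent e0 aE.
rewrite -/(esum _ _) (esumID A)// !setTI -[X in (X + _ - _)%E]/(esum _ _).
have -> : (\esum_(i in A) a i = \sum_(i \in A) a i)%E by rewrite -esum_fset.
move=> h; exists A => //; move: h.
have sA : (\sum_(i \in A) a i)%E \is a fin_num.
  rewrite -esum_fset// ge0_fin_numE ?esum_ge0//.
  apply: le_lt_trans afin; rewrite [leRHS](esumID A)// setTI.
  by rewrite leeDl// esum_ge0.
by rewrite lteBlDr// addeC [X in (_ < X)%E]addeC lteD2rE.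
Qed.

End Esum.

(** * The energy, dominated convergence and closures in [Dp] *)

Section Energy.
Variables (R : realType) (p : R) (p1 : 1 < p) (G : groupType) (S : {fset G}).
Local Notation C := R[i].
Implicit Types (f g h v : G -> C) (w u : nat -> G -> C) (s x y : G).

Let p0 : 0 < p. Proof. exact: lt_trans ltr01 p1. Qed.

(** The p-th power of [Dp_norm], kept in the extended reals so that it makes sense outside [Dp] as
    well. *)
Definition energy f : \bar R :=
  (\sum_(s <- S) diffsum p f s + (cmod (f 1%g) `^ p)%:E)%E.

Lemma diffsum_ge0 f s : (0 <= diffsum p f s)%E.
Proof. by apply: esum_ge0 => x _; rewrite lee_fin powR_ge0. Qed.

Lemma sum_diffsum_ge0 f : (0 <= \sum_(s <- S) diffsum p f s)%E.
Proof. by apply: sume_ge0 => s _; exact: diffsum_ge0. Qed.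

Lemma energy_ge0 f : (0 <= energy f)%E.
Proof. by rewrite adde_ge0 ?sum_diffsum_ge0// lee_fin powR_ge0. Qed.

Lemma diffsum_le_energy f s : s \in S -> (diffsum p f s <= energy f)%E.
Proof.
move=> sS; rewrite /energy (big_rem s)//= -addeA leeDl// adde_ge0 ?lee_fin ?powR_ge0//.
by apply: sume_ge0 => t _; exact: diffsum_ge0.
Qed.

Lemma cmod1_le_energy f : ((cmod (f 1%g) `^ p)%:E <= energy f)%E.
Proof. by rewrite leeDr// sum_diffsum_ge0. Qed.

Lemma Dp_norm_lt f (e : R) : 0 < e -> Dp p S f ->
  (Dp_norm p S f < e) = (energy f < (e `^ p)%:E)%E.
Proof.
move=> e0 Df; have fs s : s \in S -> diffsum p f s \is a fin_num.
  by move=> sS; rewrite ge0_fin_numE ?diffsum_ge0//; exact: Df.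
have sum0 : 0 <= \sum_(s <- S) fine (diffsum p f s).
  by apply: sumr_ge0 => s _; rewrite fine_ge0 ?diffsum_ge0.
have -> : energy f = ((\sum_(s <- S) fine (diffsum p f s)) + cmod (f 1%g) `^ p)%:E.
  rewrite EFinD /energy -sumEFin; congr (_ + _)%E.
  by apply: eq_big_seq => s /fs /fineK.
rewrite lte_fin /Dp_norm /Dp_seminorm -powRrM mulVf ?lt0r_neq0// powRr1//.
set a := _ + _; have a0 : 0 <= a by rewrite addr_ge0 ?powR_ge0.
apply/idP/idP => h.
  rewrite -[a]powRr1// -(mulVf (lt0r_neq0 p0)) powRrM.
  by apply: gt0_ltr_powR h => //; rewrite ?nnegrE ?powR_ge0 ?ltW.
rewrite -[e]powRr1 ?ltW// -(mulfV (lt0r_neq0 p0)) powRrM.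
by apply: gt0_ltr_powR h; rewrite ?invr_gt0// ?nnegrE ?powR_ge0.
Qed.

(* A quasi-triangle inequality up to a constant replaces Minkowski's inequality,
   which is why one can work with the p-th power of the norm. *)
Lemma energy_comb (k l : R) f g h : 0 <= k -> 0 <= l ->
  (forall x y, cmod (f x - f y) <= k * cmod (g x - g y) + l * cmod (h x - h y)) ->
  cmod (f 1%g) <= k * cmod (g 1%g) + l * cmod (h 1%g) ->
  (energy f <= ((2 * Num.max k l) `^ p)%:E * (energy g + energy h))%E.
Proof.
move=> k0 l0 fgh f1; set K := _ `^ p.
have K0 : 0 <= K by exact: powR_ge0.
have dK s : (diffsum p f s <= K%:E * (diffsum p g s + diffsum p h s))%E.
  rewrite -esumD; try by move=> x _; rewrite lee_fin powR_ge0.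
  apply: le_trans (ge0_esumZl_le _ K0 _); last first.
    by move=> x; rewrite adde_ge0// lee_fin powR_ge0.
  apply: le_esum => x _; rewrite -EFinD -EFinM lee_fin.
  by apply: powR_comb => //; rewrite ?cmod_ge0 ?(ltW p0).
rewrite /energy addeACA ge0_muleDr ?adde_ge0 ?sum_diffsum_ge0 ?lee_fin ?powR_ge0//.
apply: leeD; last first.
  by rewrite -EFinD -EFinM lee_fin; apply: powR_comb => //; rewrite ?cmod_ge0 ?(ltW p0).
rewrite -big_split/= ge0_sume_distrr; last by move=> s _; rewrite adde_ge0 ?diffsum_ge0.
by apply: lee_sum => s _; exact: dK.
Qed.

Lemma energyD f g : (energy (f + g)%R <= (2 `^ p)%:E * (energy f + energy g))%E.
Proof.
rewrite -[X in X `^ p]mulr1 -[X in _ * X](maxxx 1).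
apply: energy_comb => // [x y|]; rewrite !mul1r; last exact: cmodD.
by apply: le_trans (cmodD _ _); rewrite /= opprD addrACA.
Qed.

(** The threshold absorbs the factor [2 ^ p] of [energyD] and splits the rest evenly. *)
Lemma energyD_lt f g (e : R) : (energy f < (e / 2 `^ p / 2)%:E)%E ->
  (energy g < (e / 2 `^ p / 2)%:E)%E -> (energy (f + g)%R < e%:E)%E.
Proof.
move=> fe ge; apply: (le_lt_trans (energyD _ _)).
apply: (@lt_le_trans _ _ ((2 `^ p)%:E * (e / 2 `^ p)%:E)%E).
  rewrite [X in (_ < _ * X%:E)%E]splitr EFinD lte_pmul2l ?lte_fin ?powR_gt0//.
  exact: lteD.
by rewrite -EFinM lee_fin mulrC divfK// lt0r_neq0// powR_gt0.
Qed.

Lemma energyB f g : (energy (f - g)%R <= (2 `^ p)%:E * (energy f + energy g))%E.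
Proof.
rewrite -[X in X `^ p]mulr1 -[X in _ * X](maxxx 1).
apply: energy_comb => // [x y|]; rewrite !mul1r.
  by rewrite -(cmodN (g x - g y)); apply: le_trans (cmodD _ _); rewrite /= !opprD addrACA.
by rewrite -(cmodN (g 1%g)); exact: cmodD.
Qed.

Lemma energyZ (a : C) f :
  (energy (a *: f)%R <= ((2 * cmod a) `^ p)%:E * (energy f + energy f))%E.
Proof.
rewrite -[X in _ * X](maxxx (cmod a)); apply: energy_comb => [||x y|]; try exact: cmod_ge0.
  by rewrite /= -mulrBr Normc.normcM lerDl mulr_ge0 ?cmod_ge0.
by rewrite [(a *: f) _]/= Normc.normcM lerDl mulr_ge0 ?cmod_ge0.
Qed.

Lemma energy_cst (c : C) : energy (cst c) = (cmod c `^ p)%:E.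
Proof. by rewrite /energy big1 ?add0e// => s _; exact: diffsum_cst. Qed.

Lemma vanishing_diffsum w s : s \in S ->
  vanishing (fun n => energy (w n)) -> vanishing (fun n => diffsum p (w n) s).
Proof. by move=> sS; apply: vanishing_le => n; exact: diffsum_le_energy. Qed.

(** The elements [a] for which the increments from [x] to [x * a] tend to 0 at every [x] form a
    subgroup containing [S], hence all of [G]. Every point is thus linked to the identity, where the
    energy controls the value itself. *)
Lemma energy_pointwise w : generating_set S ->
  vanishing (fun n => energy (w n)) -> forall x, cvanishing (fun n => w n x).
Proof.
move=> Sgen wv.
pose H : {pred G} := fun a => `[< forall x, cvanishing (fun n => w n (x * a)%g - w n x) >].
have HP a : reflect (forall x, cvanishing (fun n => w n (x * a)%g - w n x)) (a \in H).
  exact: asboolP.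
have Hg : forall a, a \in H.
  apply: (Sgen H) => [|s sS].
    split.
      by apply/HP => x e e0; apply: filterE => n; rewrite mulg1 subrr Normc.normc0.
    move=> a b /HP Ha /HP Hb; apply/HP => x.
    (* One goes from [x] to [x * a], then back by [b] to [x * (a / b)]. *)
    have := cvanishingD (cvanishingN (Hb (x * (a / b))%g)) (Ha x).
    suff -> : (fun n => - (w n (x * (a / b) * b)%g - w n (x * (a / b))%g) +
       (w n (x * a)%g - w n x)) = fun n => w n (x * (a / b))%g - w n x by [].
    by apply/funext => n; rewrite mulgA mulgVK opprB addrA subrK.
  apply/HP => x; apply: (powR_vanishing p0).
  apply: vanishing_le (vanishing_diffsum sS wv) => n.
  (* The term of [diffsum] at [x * s] is the increment between [x * s] and [x]. *)
  apply: le_trans (esum_term_le _ (x := (x * s)%g) _) => //.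
  by rewrite mulgK cmodB.
move=> x; have w1 : cvanishing (fun n => w n 1%g).
  apply: (powR_vanishing p0); apply: vanishing_le wv => n; exact: cmod1_le_energy.
have := cvanishingD (HP _ (Hg x) 1%g) w1.
by under eq_fun do rewrite mul1g subrK.
Qed.

(* Dominated convergence, with a dominating function that may vary with [n]
   provided it converges in the p-norm. *)
Lemma energy_dominated w u v (k : R) : 0 <= k -> Dp p S v ->
  (forall n x y, cmod (w n x - w n y) <=
     k * cmod (u n x - u n y) + k * cmod (v x - v y)) ->
  vanishing (fun n => energy (u n)) ->
  (forall x, cvanishing (fun n => w n x)) ->
  vanishing (fun n => energy (w n)).
Proof.
move=> k0 Dv wuv uv w0.
apply: vanishingD; last exact: vanishing_powR.
apply: vanishing_sum => s sS; apply: vanishing_approx => e e0.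
set K := (2 * Num.max k k) `^ p; have K0 : 0 <= K by exact: powR_ge0.
have K1 : 0 < K + 1 by rewrite ltr_wpDl.
(* Off the finite set [A] the increments of [v] contribute less than [e / (K + 1)], hence at most
   [e] after multiplication by [K]. *)
have [A finA tailA] := esum_tail
  (fun x => powR_ge0 (cmod (v (x * s^-1)%g - v x)) p : (0 <= _%:E)%E)
  (Dv _ sS) (divr_gt0 e0 K1).
(* The finite sum over [A] vanishes by pointwise convergence, the other term by the convergence of
   [u]. *)
exists (fun n => \sum_(x <- fset_set A) (cmod (w n (x * s^-1)%g - w n x) `^ p)%:E
   + K%:E * diffsum p (u n) s)%E.
  apply: vanishingD.
    apply: vanishing_sum => x _; apply: vanishing_powR => //.
    by apply: cvanishingD => //; exact: cvanishingN.
  by apply: vanishingZ; [move=> n; exact: diffsum_ge0|exact: vanishing_diffsum].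
move=> n; rewrite {1}/diffsum (esumID A); last by move=> x _; rewrite lee_fin powR_ge0.
rewrite !setTI -addeA; apply: leeD.
  rewrite esum_fset//; last by move=> x _; rewrite lee_fin powR_ge0.
  by rewrite fsbig_finite.
apply: (@le_trans _ _ (K%:E * (\esum_(x in ~` A)
    ((cmod (u n (x * s^-1)%g - u n x) `^ p)%:E
     + (cmod (v (x * s^-1)%g - v x) `^ p)%:E)))%E).
  apply: le_trans (ge0_esumZl_le _ K0 _); last first.
    by move=> x; rewrite adde_ge0// lee_fin powR_ge0.
  apply: le_esum => x _; rewrite -EFinD -EFinM lee_fin.
  by apply: powR_comb => //; rewrite ?cmod_ge0 ?(ltW p0).
rewrite esumD; try by move=> x _; rewrite lee_fin powR_ge0.
rewrite ge0_muleDr ?esum_ge0//; try by move=> x _; rewrite lee_fin powR_ge0.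
apply: leeD.
  apply: lee_wpmul2l; first by rewrite lee_fin.
  rewrite /diffsum [leRHS](esumID A); last by move=> x _; rewrite lee_fin powR_ge0.
  by rewrite !setTI leeDr// esum_ge0// => x _; rewrite lee_fin powR_ge0.
apply: (@le_trans _ _ (K%:E * (e / (K + 1))%:E)%E).
  by apply: lee_wpmul2l; rewrite ?lee_fin// ltW.
rewrite -EFinM lee_fin mulrA ler_pdivrMr// mulrC ler_wpM2l ?ltW//; lra.
Qed.

Lemma Dp_comb (k l : R) f g h : 0 <= k -> 0 <= l -> Dp p S g -> Dp p S h ->
  (forall x y, cmod (f x - f y) <= k * cmod (g x - g y) + l * cmod (h x - h y)) ->
  Dp p S f.
Proof.
move=> k0 l0 Dg Dh fgh s sS; apply: (diffsum_comb (ltW p0) k0 l0 fgh).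
  exact: Dg.
exact: Dh.
Qed.

Lemma DpD f g : Dp p S f -> Dp p S g -> Dp p S (f + g).
Proof.
move=> Df Dg; apply: (Dp_comb ler01 ler01 Df Dg) => x y; rewrite !mul1r.
by apply: le_trans (cmodD _ _); rewrite /= opprD addrACA.
Qed.

Lemma DpN f : Dp p S f -> Dp p S (- f).
Proof.
move=> Df; apply: (Dp_comb ler01 (lexx 0) Df Df) => x y.
by rewrite mul1r mul0r addr0 /= -opprD cmodN.
Qed.

Lemma Dp_cst (c : C) : Dp p S (cst c).
Proof. by move=> s _; rewrite diffsum_cst// ltry. Qed.

Lemma Dp_closureP (A : set (G -> C)) f : A `<=` Dp p S ->
  Dp_closure p S A f <->
  Dp p S f /\ forall e : R, 0 < e -> exists2 a, A a & (energy (f - a)%R < e%:E)%E.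
Proof.
move=> AD; have DB a : Dp p S f -> A a -> Dp p S (f - a).
  by move=> Df /AD Da; apply: DpD => //; exact: DpN.
split=> -[Df fA]; split=> // e e0.
  have [a Aa] := fA _ (powR_gt0 p^-1 e0).
  rewrite Dp_norm_lt ?powR_gt0//; last exact: DB.
  by rewrite -powRrM mulVf ?lt0r_neq0// powRr1 ?ltW//; exists a.
have [a Aa fa] := fA _ (powR_gt0 p e0).
by exists a => //; rewrite Dp_norm_lt//; exact: DB.
Qed.

(** The sequential form of the closure, to which dominated convergence applies. *)
Lemma Dp_closure_seqP (A : set (G -> C)) f : A `<=` Dp p S ->
  Dp_closure p S A f <-> Dp p S f /\
    exists2 a : nat -> G -> C, (forall n, A (a n)) & vanishing (fun n => energy (f - a n)%R).
Proof.
move=> AD; split=> [/(Dp_closureP f AD)[Df fA]|[Df [a Aa va]]].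
  split=> //; have h n : exists a, A a /\ (energy (f - a)%R < (n.+1%:R^-1)%:E)%E.
    by have [|a] := fA n.+1%:R^-1; [rewrite invr_gt0|exists a].
  have [a ha] := choice h; exists a => [n|e e0]; first by have [] := ha n.
  have := near_infty_natSinv_lt (PosNum e0); apply: filterS => n /= ne.
  by have [_ /lt_trans] := ha n; apply; rewrite lte_fin.
apply/Dp_closureP => //; split=> // e /va/filter_ex[n an].
by exists (a n).
Qed.

Lemma Dp_closure_limit (A : set (G -> C)) w f : A `<=` Dp p S ->
  (forall n, Dp_closure p S A (w n)) -> Dp p S f ->
  vanishing (fun n => energy (f - w n)%R) -> Dp_closure p S A f.
Proof.
move=> AD Aw Df fw; apply/Dp_closureP => //; split=> // e e0.
have e'0 : 0 < e / 2 `^ p / 2 by rewrite !divr_gt0// powR_gt0.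
have [n fn] := filter_ex (fw _ e'0).
have /(Dp_closureP _ AD)[_ /(_ _ e'0)[a Aa na]] := Aw n.
exists a => //; rewrite -(subrK (w n) f) -addrA.
exact: energyD_lt.
Qed.

Lemma Dp_closureD (A : set (G -> C)) f g : A `<=` Dp p S ->
  (forall a b, A a -> A b -> A (a + b)) ->
  Dp_closure p S A f -> Dp_closure p S A g -> Dp_closure p S A (f + g).
Proof.
move=> AD AA /(Dp_closure_seqP _ AD)[Df [a Aa fa]] /(Dp_closure_seqP _ AD)[Dg [b Ab gb]].
apply/(Dp_closure_seqP _ AD); split; first exact: DpD.
exists (fun n => a n + b n) => [n|]; first exact: AA.
apply: vanishing_le (vanishingZ (2 `^ p) _ (vanishingD fa gb)) => n.
  by rewrite opprD addrACA; exact: energyD.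
by rewrite adde_ge0 ?energy_ge0.
Qed.

Lemma Dp_closureN (A : set (G -> C)) f : A `<=` Dp p S ->
  (forall a, A a -> A (- a)) -> Dp_closure p S A f -> Dp_closure p S A (- f).
Proof.
move=> AD AN /(Dp_closure_seqP _ AD)[Df [a Aa fa]].
apply/(Dp_closure_seqP _ AD); split; first exact: DpN.
exists (fun n => - a n) => [n|]; first exact: AN.
apply: vanishing_le (vanishingZ ((2 * cmod (-1 : C)) `^ p) _ (vanishingD fa fa)) => n.
  by rewrite -opprD -scaleN1r; exact: energyZ.
by rewrite adde_ge0 ?energy_ge0.
Qed.

Lemma sub_Dp_closure (A : set (G -> C)) : A `<=` Dp p S -> A `<=` Dp_closure p S A.
Proof.
move=> AD f Af; apply/(Dp_closureP _ AD); split; first exact: AD.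
move=> e e0; exists f => //.
by rewrite subrr (energy_cst 0) Normc.normc0 powR0 ?lt0r_neq0 ?lte_fin.
Qed.

End Energy.

(** * Truncation of functions in [Dp] and in [lp] *)

Section Truncation.
Variables (R : realType) (p : R) (p1 : 1 < p) (G : groupType) (S : {fset G}).
Hypothesis S_gen : generating_set S.
Local Notation C := R[i].
Local Notation energy := (energy p S).
Local Notation Dp := (Dp p S).
Local Notation fs := (@finitely_supported R G).
Implicit Types (f g h v : G -> C) (w u : nat -> G -> C) (s x y : G).

Let p0 : 0 < p. Proof. exact: lt_trans ltr01 p1. Qed.

Lemma Dp_ctrunc M f : Dp f -> Dp (ctrunc M \o f).
Proof.
move=> Df; apply: (Dp_comb p1 ler01 (lexx 0) Df Df) => x y.
by rewrite mul1r mul0r addr0 /= ctrunc_lipschitz.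
Qed.

(** The increments of the difference are at most those of [f] plus those of [u n], hence at most
    those of [f - u n] plus twice those of [f]. Dominated convergence applies because [u n] tends to
    [f] pointwise. *)
Lemma vanishing_ctrunc M f u : Dp f -> vanishing (fun n => energy (f - u n)%R) ->
  vanishing (fun n => energy ((ctrunc M \o f) - (ctrunc M \o u n))%R).
Proof.
move=> Df uf; apply: (energy_dominated p1 (ler0n _ 2) Df _ uf) => [n x y|x e e0].
  have := ctrunc_lipschitz M (f x) (f y); have := ctrunc_lipschitz M (u n y) (u n x).
  have -> : ((ctrunc M \o f) - (ctrunc M \o u n)) x -
      ((ctrunc M \o f) - (ctrunc M \o u n)) y =
    (ctrunc M (f x) - ctrunc M (f y)) + (ctrunc M (u n y) - ctrunc M (u n x)).
    by rewrite !fctE /=; ring.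
  have := cmodD (ctrunc M (f x) - ctrunc M (f y)) (ctrunc M (u n y) - ctrunc M (u n x)).
  have := cmodD ((f - u n) x - (f - u n) y) (f y - f x).
  have -> : (f - u n) x - (f - u n) y + (f y - f x) = u n y - u n x.
    by rewrite !fctE; ring.
  rewrite (cmodB (f y)).
  have := cmod_ge0 ((f - u n) x - (f - u n) y).
  lra.
have := energy_pointwise p1 S_gen uf x e0; apply: filterS => n.
by apply: le_lt_trans; exact: ctrunc_lipschitz.
Qed.

(** The values are at most [2 / (n + 1)] in modulus and the increments are dominated by those of
    [f]. *)
Lemma vanishing_ctrunc_small f : Dp f ->
  vanishing (fun n => energy (ctrunc n.+1%:R^-1 \o f)).
Proof.
move=> Df.
apply: (@energy_dominated _ _ p1 _ _ _ (fun=> 0) f 1 ler01 Df) => [n x y||x e e0].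
- by rewrite subrr Normc.normc0 !mul1r add0r ctrunc_lipschitz.
- move=> e e0; apply: filterE => n.
  by rewrite (energy_cst p1 S 0) Normc.normc0 powR0 ?lt0r_neq0// lte_fin.
have e20 : 0 < e / 2 by rewrite divr_gt0.
have := near_infty_natSinv_lt (PosNum e20); apply: filterS => n /= ne.
apply: le_lt_trans (ctrunc_bound _ _) _; first by rewrite invr_ge0.
by move: ne; set d := _^-1; lra.
Qed.

(** At each point the difference is 0 once [n] reaches the modulus of [f] there; its increments are
    at most twice those of [f]. *)
Lemma vanishing_ctrunc_large f : Dp f ->
  vanishing (fun n => energy (f - (ctrunc n%:R \o f))%R).
Proof.
move=> Df.
apply: (@energy_dominated _ _ p1 _ _ _ (fun=> 0) f 2 (ler0n _ 2) Df) => [n x y||x e e0].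
- rewrite subrr Normc.normc0 mulr0 add0r.
  have -> : (f - (ctrunc n%:R \o f)) x - (f - (ctrunc n%:R \o f)) y =
    (f x - f y) - (ctrunc n%:R (f x) - ctrunc n%:R (f y)) by rewrite !fctE /=; ring.
  apply: (le_trans (cmodD _ _)); rewrite cmodN.
  by have := ctrunc_lipschitz n%:R (f x) (f y); lra.
- move=> e e0; apply: filterE => n.
  by rewrite (energy_cst p1 S 0) Normc.normc0 powR0 ?lt0r_neq0// lte_fin.
have := nbhs_infty_ger (cmod (f x)); apply: filterS => n /= fn.
by rewrite -[X in cmod X]/(f x - ctrunc n%:R (f x)) ctrunc_id// subrr Normc.normc0.
Qed.

(** Right multiplication by [s^-1] is a bijection, so the translate of [f] has the same p-sum as
    [f]. *)
Lemma lp_Dp : @lp R p G `<=` Dp.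
Proof.
move=> f lf s sS; apply: (@esum_dominated _ _ ((2 * Num.max 1 1) `^ p) _
  (fun x => cmod (f (x * s^-1)%g) `^ p + cmod (f x) `^ p)).
- by move=> x; rewrite addr_ge0 ?powR_ge0.
- move=> x; apply: powR_comb; rewrite ?cmod_ge0// ?(ltW p0)// !mul1r.
  by apply: (le_trans (cmodD _ _)); rewrite cmodN.
- exact: powR_ge0.
- under eq_esum do rewrite EFinD.
  rewrite esumD; try by move=> x _; rewrite lee_fin powR_ge0.
  apply: lte_add_pinfty; last exact: lf.
  rewrite -(@reindex_esum _ _ _ setT setT (fun x => x * s^-1)%g
    (fun x => (cmod (f x) `^ p)%:E))//.
  split=> // [x y _ _ /mulIg//|x _]; exists (x * s)%g => //; exact: mulgK.
Qed.

Lemma fs_lp : fs `<=` @lp R p G.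
Proof.
move=> f ffin; rewrite /lp/= (esumID [set x | f x != 0]); last first.
  by move=> x _; rewrite lee_fin powR_ge0.
rewrite !setTI [X in (_ + X)%E]esum1 ?adde0; last first.
  move=> x /= /negP; rewrite negbK => /eqP ->.
  by rewrite Normc.normc0 powR0// lt0r_neq0.
rewrite esum_fset//; last by move=> x _; rewrite lee_fin powR_ge0.
by rewrite fsbig_finite// sumEFin ltry.
Qed.

Lemma fs_Dp : fs `<=` Dp.
Proof. exact: subset_trans fs_lp lp_Dp. Qed.

Lemma lp_plus_constants_Dp : @lp_plus_constants R p G `<=` Dp.
Proof. by move=> _ [h [c [/lp_Dp Dh ->]]]; apply: DpD => //; exact: Dp_cst. Qed.

Lemma lp_level_finite h (e : R) : lp p h -> 0 < e -> finite_set [set x | e <= cmod (h x)].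
Proof.
move=> lh e0.
have [A finA tailA] := esum_tail (fun x => powR_ge0 (cmod (h x)) p : (0 <= _%:E)%E)
  lh (powR_gt0 p e0).
apply: sub_finite_set finA => x /= ex; apply: contrapT => nAx.
have := le_lt_trans (@esum_term_le _ _ _ (~` A) x nAx) tailA.
rewrite lte_fin ltNge => /negP; apply; apply: ge0_ler_powR ex; first exact: ltW.
  by rewrite nnegrE ltW.
by rewrite nnegrE cmod_ge0.
Qed.

(** The difference is 0 wherever [h] is at most [e] in modulus. Small [e] gives finitely supported
    approximations of [h]. *)
Lemma lp_sub_ctrunc h (e : R) : lp p h -> 0 < e -> fs (h - (ctrunc e \o h)).
Proof.
move=> lh e0; apply: sub_finite_set (lp_level_finite lh e0) => x /=.
apply: contraR; rewrite -ltNge => /ltW xe.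
by rewrite ?negbK -[X in X == 0]/(h x - ctrunc e (h x)) ctrunc_id// subrr.
Qed.

End Truncation.

(** * The ideal of bounded functions in the closure of CG *)

Section Ideal.
Variables (R : realType) (p : R) (p1 : 1 < p) (G : groupType) (S : {fset G}).
Hypothesis S_gen : generating_set S.
Local Notation C := R[i].
Local Notation energy := (energy p S).
Local Notation Dp := (Dp p S).
Local Notation fs := (@finitely_supported R G).
Implicit Types (f g h v : G -> C) (w u : nat -> G -> C) (s x y : G).

(* The paper's B(closure of CG). *)
Definition null_ideal : set (G -> C) :=
  [set h | Dp_closure p S fs h /\ bounded_function h].

Lemma fs_ctrunc M f : 0 <= M -> fs f -> fs (ctrunc M \o f).
Proof.
move=> M0; apply: sub_finite_set => x /=; apply: contra => /eqP ->.
by rewrite ctrunc0.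
Qed.

Lemma null_ideal_fs f : fs f -> null_ideal f.
Proof.
move=> ff; split.
  exact: (sub_Dp_closure p1 (fs_Dp p1 (S := S))).
exists (\sum_(x <- fset_set [set x | f x != 0]) cmod (f x)) => x.
have [-> |fx0] := eqVneq (f x) 0.
  by rewrite Normc.normc0 sumr_ge0// => y _; exact: cmod_ge0.
rewrite (big_rem x)/=; last by rewrite in_fset_set// inE.
by rewrite lerDl sumr_ge0// => y _; exact: cmod_ge0.
Qed.

(** The approximants are truncated along with [h]; truncation fixes 0, so their supports stay
    finite. *)
Lemma null_ideal_ctrunc M h : 0 <= M -> null_ideal h -> null_ideal (ctrunc M \o h).
Proof.
move=> M0 [clh _]; split; last first.
  by exists (M + M) => x; exact: ctrunc_bound.
move: clh; move/(Dp_closure_seqP p1 _ (fs_Dp p1 (S := S))) => [Dh [a fa ha]].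
apply/(Dp_closure_seqP p1 _ (fs_Dp p1 (S := S))); split; first exact: Dp_ctrunc.
exists (fun n => ctrunc M \o a n) => [n|]; first exact: fs_ctrunc.
exact: vanishing_ctrunc.
Qed.

(** The approximants [a n] of [h] need not be uniformly bounded. Truncating at a bound [M] of [h]
    leaves [h] unchanged and makes them so; their products with [f] then converge by dominated
    convergence. *)
Lemma null_idealM f h : Dp f -> bounded_function f -> null_ideal h -> null_ideal (f * h).
Proof.
move=> Df [N fN] [+ [M hM]].
have M0 : 0 <= M by apply: le_trans (hM 1%g); exact: cmod_ge0.
have N0 : 0 <= N by apply: le_trans (fN 1%g); exact: cmod_ge0.
move=> /(Dp_closure_seqP p1 _ (fs_Dp p1 (S := S))) [Dh [a fa ha]].
have := vanishing_ctrunc p1 S_gen M Dh ha.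
have -> : ctrunc M \o h = h by apply/funext => x /=; rewrite ctrunc_id.
move=> hb.
have fhB : f * h \in BDp_pred p S.
  by apply: (BDp_mul p1); rewrite inE; split=> //; [exists N|exists M].
move: fhB; rewrite inE => -[Dfh Bfh]; split=> //.
apply/(Dp_closure_seqP p1 _ (fs_Dp p1 (S := S))); split=> //.
exists (fun n => f * (ctrunc M \o a n)) => [n|].
  apply: sub_finite_set (fs_ctrunc M0 (fa n)) => x /=; apply: contra => /eqP.
  by rewrite -[X in _ -> X == 0]/(f x * ctrunc M (a n x)) => ->; rewrite mulr0.
(* One constant above both the bound [N] of [f] and the bound [M + (M + M)] of [h] minus its
   truncated approximant, the two factors in the product rule. *)
have K0 : 0 <= N + (M + (M + M)) by rewrite !addr_ge0.
apply: (energy_dominated p1 K0 Df _ hb) => [n x y|x].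
  set u := h - _.
  have uM z : cmod (u z) <= M + (M + M).
    apply: (le_trans (cmodD _ _)); rewrite cmodN; apply: lerD; first exact: hM.
    exact: ctrunc_bound.
  have -> : (f * h - f * (ctrunc M \o a n)) x - (f * h - f * (ctrunc M \o a n)) y =
      f x * (u x - u y) + (f x - f y) * u y.
    by rewrite /u !fctE /=; ring.
  apply: (le_trans (cmodD _ _)); rewrite !Normc.normcM [_ * cmod (u y)]mulrC.
  apply: lerD; apply: ler_wpM2r; rewrite ?cmod_ge0//.
    by apply: (le_trans (fN x)); rewrite lerDl !addr_ge0.
  by apply: (le_trans (uM y)); rewrite lerDr.
have hx := energy_pointwise p1 S_gen hb x.
move=> e e0; have N1 : 0 < N + 1 by rewrite ltr_wpDl.
apply: filterS (hx _ (divr_gt0 e0 N1)) => n.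
rewrite ltr_pdivlMr// => xe.
have -> : (f * h - f * (ctrunc M \o a n)) x = f x * (h - (ctrunc M \o a n)) x.
  by rewrite !fctE /=; ring.
rewrite Normc.normcM; apply: le_lt_trans xe; rewrite mulrC.
by apply: ler_wpM2l; rewrite ?cmod_ge0//; apply: (le_trans (fN x)); rewrite lerDl.
Qed.

End Ideal.

(** Solves the inequality for [t]; it bounds the constants in [closure_plus_constants]. *)
Lemma powR_inv_bound (R : realType) (p d t K : R) : 0 < p -> 0 < d -> 0 < t ->
  d <= (2 * t^-1) `^ p * K -> t <= (2 `^ p * K / d) `^ p^-1.
Proof.
move=> p0 d0 t0; rewrite [(2 * t^-1) `^ p]powRM ?invr_ge0 ?(ltW t0)// => dt.
have tB : t `^ p <= 2 `^ p * K / d.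
  rewrite ler_pdivlMr//; apply: (le_trans (ler_wpM2l (powR_ge0 _ _) dt)).
  rewrite !mulrA [_ * 2 `^ p]mulrC -[X in X * K <= _]mulrA -powRM ?invr_ge0 ?(ltW t0)//.
  by rewrite mulfV ?lt0r_neq0// powR1 mulr1.
have -> : t = (t `^ p) `^ p^-1 by rewrite -powRrM mulfV ?lt0r_neq0// powRr1 ?ltW.
have tp0 := powR_ge0 t p.
have r0 : 0 <= p^-1 by rewrite invr_ge0 ltW.
exact: (ge0_ler_powR r0 tp0 (le_trans tp0 tB) tB).
Qed.

(** * Reduced cohomology and the closure of [lp_plus_constants] *)

Section ReducedCohomology.
Variables (R : realType) (p : R) (p1 : 1 < p) (G : groupType) (S : {fset G}).
Local Notation C := R[i].
Local Notation energy := (energy p S).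
Local Notation Dp := (Dp p S).
Local Notation fs := (@finitely_supported R G).
Local Notation lpc := (@lp_plus_constants R p G).
Implicit Types (f g h v : G -> C) (w u : nat -> G -> C) (s x y : G).

Let p0 : 0 < p. Proof. exact: lt_trans ltr01 p1. Qed.

Lemma fsD f g : fs f -> fs g -> fs (f + g).
Proof.
move=> ff fg; apply: (@sub_finite_set _ _ ([set x | f x != 0] `|` [set x | g x != 0])).
  move=> x /= fgx; have [fx0|] := eqVneq (f x) 0; last by left.
  by right; move: fgx; rewrite -[X in X != 0]/(f x + g x) fx0 add0r.
by rewrite finite_setU.
Qed.

Lemma fsN f : fs f -> fs (- f).
Proof.
apply: sub_finite_set => x /=.
by rewrite -[X in X != 0]/(- f x) oppr_eq0.
Qed.

Lemma lpD f g : lp p f -> lp p g -> lp p (f + g).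
Proof.
move=> lf lg; apply: (@esum_dominated _ _ ((2 * Num.max 1 1) `^ p) _
  (fun x => cmod (f x) `^ p + cmod (g x) `^ p)).
- by move=> x; rewrite addr_ge0 ?powR_ge0.
- move=> x; apply: powR_comb; rewrite ?cmod_ge0// ?(ltW p0)// !mul1r.
  exact: cmodD.
- exact: powR_ge0.
- under eq_esum do rewrite EFinD.
  rewrite esumD; try by move=> x _; rewrite lee_fin powR_ge0.
  exact: lte_add_pinfty.
Qed.

Lemma lpN f : lp p f -> lp p (- f).
Proof.
move=> lf; rewrite /lp/= (@eq_esum _ _ _ _ (fun x => (cmod (f x) `^ p)%:E))// => x _.
by rewrite cmodN.
Qed.

Lemma fsZ (c : C) f : fs f -> fs (c *: f).
Proof.
apply: sub_finite_set => x /=; apply: contra => /eqP fx0.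
by rewrite -[X in X == 0]/(c * f x) fx0 mulr0.
Qed.

Lemma lp_plus_constantsD f g : lpc f -> lpc g -> lpc (f + g).
Proof.
move=> [h [c [lh ->]]] [k [d [lk ->]]]; exists (h + k), (c + d).
by split; [exact: lpD|rewrite addrACA].
Qed.

Lemma lp_plus_constantsN f : lpc f -> lpc (- f).
Proof.
move=> [h [c [lh ->]]]; exists (- h), (- c).
by split; [exact: lpN|rewrite opprD].
Qed.

(** The closure is an additive group, so a coset is the zero coset exactly when its representative
    lies in the closure. *)
Lemma reduced_H1_trivial : reduced_H1 p S = [set reduced_H1_zero p S] <->
  Dp `<=` Dp_closure p S lpc.
Proof.
have lpcD := @lp_plus_constants_Dp R p p1 G S.
have lpc0 : lpc 0.
  exists 0, 0; split; last by rewrite addr0.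
  apply: (@fs_lp R p p1 G); rewrite /fs/= (_ : mkset _ = set0)//.
  by apply/seteqP; split => x //=; rewrite eqxx.
split=> [H f Df|DN].
  have /= : reduced_H1 p S (affine_coset (Dp_closure p S lpc) f) by exists f.
  rewrite H/= => fN.
  have : affine_coset (Dp_closure p S lpc) f f.
    by exists 0; [exact: sub_Dp_closure|rewrite addr0].
  by rewrite fN => -[h Nh <-]; rewrite add0r.
have coset f : Dp f -> affine_coset (Dp_closure p S lpc) f = reduced_H1_zero p S.
  move=> /DN Nf; apply/seteqP; split=> _ [h Nh <-].
    exists (f + h); last by rewrite add0r.
    by apply: (Dp_closureD p1 lpcD) Nf Nh => *; exact: lp_plus_constantsD.
  exists (h - f); last by rewrite add0r addrC subrK.
  apply: (Dp_closureD p1 lpcD) Nh _ => *; first exact: lp_plus_constantsD.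
  by apply: (Dp_closureN p1 lpcD) Nf => *; exact: lp_plus_constantsN.
apply/seteqP; split=> [_ [f /coset Nf <-] //|_ ->].
by exists 0 => //; exact: lpcD.
Qed.

(** The truncations of [f] at level [n] are bounded and tend to [f], which reduces the claim to
    bounded functions. *)
Lemma Dp_sub_closure : (forall f, Dp f -> bounded_function f ->
    exists c : C, null_ideal p S (f - cst c)) ->
  Dp `<=` Dp_closure p S lpc.
Proof.
have lpcD := @lp_plus_constants_Dp R p p1 G S.
move=> H f Df; apply: (Dp_closure_limit p1 lpcD _ Df (vanishing_ctrunc_large p1 Df)) => n.
have [||c [cl _]] := H (ctrunc n%:R \o f).
- exact: Dp_ctrunc.
- by exists (n%:R + n%:R) => x; exact: ctrunc_bound.
move: cl => /(Dp_closure_seqP p1 _ (fs_Dp p1 (S := S))) [_ [a fa va]].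
apply/(Dp_closure_seqP p1 _ lpcD); split; first exact: Dp_ctrunc.
exists (fun n => a n + cst c) => [m|].
  by exists (a m), c; split=> //; exact: fs_lp.
by move: va; under eq_fun do rewrite -addrA -opprD [cst c + _]addrC.
Qed.

(** Cutting off the small values of an [lp] function shows that CG + C is dense in
    [lp_plus_constants]. *)
Lemma lp_plus_constants_approx f (e : R) : 0 < e -> Dp_closure p S lpc f ->
  exists a (c : C), fs a /\ (energy (f - (a + cst c))%R < e%:E)%E.
Proof.
move=> e0; pose A : set (G -> C) := [set f | exists a (c : C), fs a /\ f = a + cst c].
have AD : A `<=` Dp.
  by move=> _ [a [c [/(fs_Dp p1 (S := S)) Da ->]]]; apply: DpD => //; exact: Dp_cst.
have lpcA : lpc `<=` Dp_closure p S A.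
  move=> _ [h [c [lh ->]]]; apply/(Dp_closure_seqP p1 _ AD).
  have Dh := lp_Dp p1 (S := S) lh; split; first by apply: DpD => //; exact: Dp_cst.
  exists (fun n => h - (ctrunc n.+1%:R^-1 \o h) + cst c).
    move=> n; exists (h - (ctrunc n.+1%:R^-1 \o h)), c; split=> //.
    by apply: (lp_sub_ctrunc p1 lh); rewrite invr_gt0.
  have := vanishing_ctrunc_small p1 Dh.
  by under [X in _ -> vanishing X]eq_fun do rewrite opprD addrACA subrr addr0 subKr.
have lpcD := @lp_plus_constants_Dp R p p1 G S.
move=> /(Dp_closure_seqP p1 _ lpcD)[Df [b lb fb]].
have /(Dp_closureP p1 _ AD)[_ /(_ _ e0)[_ [a [c [fa ->]]] ?]] : Dp_closure p S A f.
  by apply: (Dp_closure_limit p1 AD _ Df fb) => n; exact: lpcA.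
by exists a, c.
Qed.

(* Constants are at a positive distance from CG, so in a converging sequence of
   CG + C the constants stay bounded, hence accumulate at some c. *)
Lemma closure_plus_constants f : ~ Dp_closure p S fs 1 -> Dp_closure p S lpc f ->
  exists c : C, Dp_closure p S fs (f - cst c).
Proof.
move=> n1 Nf; have Df : Dp f by have [] := Nf.
have fsD_ := fs_Dp p1 (S := S).
have [d d0 hd] : exists2 d : R, 0 < d & forall a, fs a -> (d%:E <= energy (1 - a)%R)%E.
  apply: contrapT => nd; apply: n1; apply/(Dp_closureP p1 _ fsD_).
  split=> [|e e0]; first exact: (Dp_cst p1 1).
  apply: contrapT => na; apply: nd; exists e => // a fa.
  by rewrite leNgt; apply/negP => h; apply: na; exists a.
have h n : exists ac : (G -> C) * C, fs ac.1 /\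
    (energy (f - (ac.1 + cst ac.2))%R < (n.+1%:R^-1)%:E)%E.
  have [|a [c h]] := @lp_plus_constants_approx f n.+1%:R^-1 _ Nf; first by rewrite invr_gt0.
  by exists (a, c).
have {h}[ac hac] := choice h.
pose a n := (ac n).1; pose c n := (ac n).2.
have fa n : fs (a n) by have [] := hac n.
have ha n : (energy (f - (a n + cst (c n)))%R < (n.+1%:R^-1)%:E)%E by have [] := hac n.
have ha1 n : (energy (f - (a n + cst (c n)))%R <= 1)%E.
  by apply: le_trans (ltW (ha n)) _; rewrite lee_fin invf_le1 ?ler1n.
(* With [t = c n - c 0], subtracting two approximations of [f] bounds the energy of
   [t + (a n - a 0)]. Divided by a large [t], this would bring 1 closer to CG than [d] allows. *)
have [M hM] : exists M : R, forall n, cmod (c n) <= M.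
  pose K : R := 2 `^ p * (1 + 1); pose B := 2 `^ p * (K + K) / d.
  have K0 : 0 <= K by rewrite mulr_ge0 ?powR_ge0.
  exists (B `^ p^-1 + cmod (c 0%N)) => n.
  rewrite -[c n](subrK (c 0%N)); apply: (le_trans (cmodD _ _)); rewrite lerD2r.
  set t := c n - c 0%N; have [->|t0] := eqVneq t 0; first by rewrite Normc.normc0 powR_ge0.
  have tk : (energy (cst t + (a n - a 0%N))%R <= K%:E)%E.
    have -> : cst t + (a n - a 0%N) =
        (f - (a 0%N + cst (c 0%N))) - (f - (a n + cst (c n))).
      by apply/funext => x; rewrite /t !fctE /=; ring.
    apply: (le_trans (energyB p1 _ _ _)); rewrite EFinM EFinD.
    by apply: lee_wpmul2l; [rewrite lee_fin powR_ge0|exact: leeD].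
  have fk : fs (- (t^-1 *: (a n - a 0%N))).
    exact: (fsN (fsZ t^-1 (fsD (fa n) (fsN (fa 0%N))))).
  have := hd _ fk.
  have -> : 1 - - (t^-1 *: (a n - a 0%N)) = t^-1 *: (cst t + (a n - a 0%N)).
    by apply/funext => x; rewrite opprK -[RHS]/(t^-1 * (t + (a n - a 0%N) x)) mulrDr mulVf.
  move=> /le_trans/(_ (energyZ p1 _ _ _)) dt.
  apply: (powR_inv_bound p0 d0 (cmod_gt0 t0)); rewrite -(Normc.normcV t) -lee_fin.
  apply: (le_trans dt); rewrite EFinM EFinD.
  by apply: lee_wpmul2l; [rewrite lee_fin powR_ge0|exact: leeD].
(* An ultrafilter finer than [\oo] replaces the extraction of a convergent subsequence. *)
have [U [UU noU]] := @ultraFilterLemma _ (\oo : set_system nat) _.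
have [z cz] := ulim_exists UU hM.
exists z; apply/(Dp_closureP p1 _ fsD_); split.
  exact: (DpD p1 Df (DpN p1 (Dp_cst p1 z))).
move=> e e0; have e'0 : 0 < e / 2 `^ p / 2 by rewrite !divr_gt0// powR_gt0.
have [n [/= cn nn]] := filter_ex (filterI (cz _ (powR_gt0 p^-1 e'0))
  (noU _ (near_infty_natSinv_lt (PosNum e'0)))).
exists (a n); first exact: fa.
have -> : f - cst z - a n = (f - (a n + cst (c n))) + cst (c n - z).
  by apply/funext => x; rewrite !fctE /=; ring.
apply: (energyD_lt p1); first by apply: (lt_trans (ha n)); rewrite lte_fin; exact: nn.
by rewrite (energy_cst p1 S) lte_fin; apply: (powR_lt_root p0 (cmod_ge0 _) e'0); exact: cn.
Qed.

End ReducedCohomology.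

(** * The boundary filter and the points of the harmonic boundary *)

Section BoundaryCharacters.
Variables (R : realType) (p : R) (p1 : 1 < p) (G : groupType) (S : {fset G}).
Hypothesis S_gen : generating_set S.
Local Notation C := R[i].
Local Notation BD := (BDp S p1).
Local Notation Dp := (Dp p S).
Local Notation fs := (@finitely_supported R G).
Local Notation null_ideal := (null_ideal p S).
Local Notation boundary := (harmonic_boundary S p1).
Implicit Types (f g h : G -> C) (x y : G).

Lemma null_idealD f g : null_ideal f -> null_ideal g -> null_ideal (f + g).
Proof.
move=> [clf [M fM]] [clg [N gN]]; split.
  by apply: (Dp_closureD p1 (fs_Dp p1 (S := S))) clf clg => *; exact: fsD.
exists (M + N) => x; apply: (le_trans (cmodD _ _)); exact: lerD.
Qed.

Lemma null_ideal_Dp f : null_ideal f -> Dp f.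
Proof. by move=> [[]]. Qed.

Lemma null_idealZ (c : C) f : null_ideal f -> null_ideal (cst c * f).
Proof. by apply: null_idealM => //; [exact: Dp_cst|exists (cmod c)]. Qed.

Lemma null_idealN f : null_ideal f -> null_ideal (- f).
Proof.
move=> /(null_idealZ (-1)).
suff -> : cst (-1) * f = - f by [].
by apply/funext => x; rewrite -[LHS]/(-1 * f x) mulN1r.
Qed.

(* The traces on G of the neighbourhoods of the harmonic boundary. *)
Definition boundary_filter : set_system G :=
  [set A | exists2 phi, null_ideal phi & forall x, ~ A x -> phi x = 1].

Lemma boundary_filter_filter : Filter boundary_filter.
Proof.
split.
- exists 0; last by move=> x /(_ I).
  apply: (null_ideal_fs p1 S).
  by rewrite /fs/= (_ : mkset _ = set0)//; apply/seteqP; split => x //=; rewrite eqxx.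
(* The witness is [1 - (1 - phi) * (1 - psi)], equal to 1 wherever [phi] or [psi] is. *)
- move=> A B [phi Iphi phi1] [psi Ipsi psi1]; exists (phi + psi + - (phi * psi)).
    apply: null_idealD; first exact: null_idealD.
    apply: null_idealN; apply: null_idealM => //; first exact: null_ideal_Dp.
    by case: Iphi.
  move=> x /not_andP[/phi1 e|/psi1 e].
    by rewrite -[LHS]/(phi x + psi x - phi x * psi x) e; ring.
  by rewrite -[LHS]/(phi x + psi x - phi x * psi x) e; ring.
- move=> A B AB [phi Iphi phi1]; exists phi => // x nBx.
  by apply: phi1 => /AB.
Qed.

Lemma boundary_filter_proper : ~ null_ideal 1 -> ProperFilter boundary_filter.
Proof.
move=> n1; apply: Build_ProperFilter; last exact: boundary_filter_filter.
move=> [phi Iphi phi1]; apply: n1.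
suff -> : 1 = phi by [].
by apply/funext => x; rewrite phi1.
Qed.

(** The witness is [min(e^2, |h|^2) / e^2], equal to 1 where [|h| >= e]. It is in the ideal since
    [|h|^2] is the product of [h] with its conjugate. *)
Lemma boundary_filter_null h (e : R) : null_ideal h -> 0 < e ->
  boundary_filter [set x | cmod (h x) < e].
Proof.
move=> Ih e0; pose hb : G -> C := fun x => conjc (h x).
have cmodJ z : cmod (conjc z) = cmod z by case: z => a b /=; rewrite sqrrN.
have Dhb : Dp hb.
  apply: (Dp_comb p1 ler01 (lexx 0) (null_ideal_Dp Ih) (null_ideal_Dp Ih)) => x y.
  by rewrite mul1r mul0r addr0 -rmorphB cmodJ.
have Bhb : bounded_function hb by case: Ih => _ [M hM]; exists M => x; rewrite cmodJ.
have e20 : 0 <= e ^+ 2 by rewrite sqr_ge0.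
exists (cst (((e ^+ 2)%:C)%C^-1) * (ctrunc (e ^+ 2) \o (hb * h))).
  by apply: null_idealZ; apply: null_ideal_ctrunc => //; exact: null_idealM.
move=> x /negP; rewrite -leNgt => ex.
have -> : (cst (((e ^+ 2)%:C)%C^-1) * (ctrunc (e ^+ 2) \o (hb * h))) x =
  ((e ^+ 2)%:C)%C^-1 * ctrunc (e ^+ 2) (conjc (h x) * h x) by [].
have -> : conjc (h x) * h x = ((cmod (h x) ^+ 2)%:C)%C.
  case: (h x) => a b; rewrite /= sqr_sqrtr ?addr_ge0 ?sqr_ge0//.
  by congr Complex; ring.
rewrite ctrunc_real ?lerXn2r ?nnegrE ?cmod_ge0 ?(ltW e0)// mulVf//.
apply/eqP => -[/eqP]; by rewrite sqrf_eq0 gt_eqF.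
Qed.

(** Bounded functions have limits along [U], and these respect the algebra operations. By
    [boundary_filter_null] they are 0 on the ideal. *)
Lemma ultrafilter_boundary (U : set_system G) : UltraFilter U -> boundary_filter `<=` U ->
  exists2 tau : BD -> C, boundary tau & forall f : BD, ulim U (val f) (tau f).
Proof.
move=> UU bU.
have BDP (f : BD) : Dp (val f) /\ bounded_function (val f).
  by have := valP f; rewrite inE.
have h (f : BD) : exists z, ulim U (val f) z.
  by have [_ [M fM]] := BDP f; exact: ulim_exists fM.
have [tau htau] := choice h.
have tau_null (f : BD) : null_ideal (val f) -> tau f = 0.
  move=> If; apply: (ulim_unique (htau f)) => e e0.
  apply: bU; under eq_set do rewrite subr0.
  exact: boundary_filter_null.
exists tau => //; split.
- split.
  + move=> a f g; apply: (ulim_unique (htau _)).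
    exact: (ulimD (ulimZ a (htau f)) (htau g)).
  + move=> f g; apply: (ulim_unique (htau _)).
    have [_ [M fM]] := BDP f.
    exact: (ulimM fM (htau f) (htau g)).
  + exists 1; suff -> : tau 1 = 1 by rewrite oner_neq0.
    apply: (ulim_unique (htau _)) => e e0; apply: filterE => x.
    change (cmod ((1 : C) - 1) < e).
    by rewrite subrr Normc.normc0.
(* The indicator of [g] lies in the ideal, yet evaluation at [g] sends it to 1. *)
- move=> [g _ gtau]; pose d : G -> C := fun x => if x == g then 1 else 0.
  have fd : fs d.
    apply: (@sub_finite_set _ _ [set g]); last exact: finite_set1.
    move=> x /=; rewrite /d; have [->//|_] := eqVneq x g.
    by rewrite eqxx.
  have Id := null_ideal_fs p1 S fd.
  have dB : d \in BDp_pred p S.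
    by rewrite inE; split; [exact: null_ideal_Dp|case: Id].
  have := tau_null (exist _ d dB) Id.
  rewrite -gtau /point_evaluation /= /d eqxx => /eqP.
  by rewrite oner_eq0.
- move=> f clf; apply: tau_null; split=> //; exact: (BDP f).2.
Qed.

(** A first ultrafilter gives [f] some limit [c]; a second one is chosen to contain a set on which
    [f] stays away from [c]. *)
Lemma two_boundary_points f : Dp f -> bounded_function f ->
  (forall c : C, ~ null_ideal (f - cst c)) ->
  exists tau1 tau2, [/\ boundary tau1, boundary tau2 & tau1 <> tau2].
Proof.
move=> Df Bf nI.
have fB : f \in BDp_pred p S by rewrite inE.
(* Otherwise [f = f * 1] would be in the ideal, against [nI] at [c = 0]. *)
have n1 : ~ null_ideal 1.
  move=> /(null_idealM p1 S_gen Df Bf); rewrite mulr1 => If; apply: (nI 0).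
  by suff -> : f - cst 0 = f by []; apply/funext => x; rewrite -[LHS]/(f x - 0) subr0.
have FP := boundary_filter_proper n1.
have [U1 [UU1 FU1]] := @ultraFilterLemma _ boundary_filter _.
have [tau1 b1 lim1] := ultrafilter_boundary UU1 FU1.
pose F : BD := exist _ f fB; pose c := tau1 F; pose g := f - cst c.
have Dg : Dp g by exact: (DpD p1 Df (DpN p1 (Dp_cst p1 c))).
have Bg : bounded_function g.
  case: Bf => M fM; exists (M + cmod c) => x; apply: (le_trans (cmodD _ _)).
  by rewrite cmodN lerD2r.
have [e e0 ne] : exists2 e : R, 0 < e & ~ boundary_filter [set x | cmod (g x) < e].
  (* If [g] tended to 0 along the filter, each [g] minus its truncation at [1 / (n + 1)] would be in
     the ideal, and so would their limit [g]. *)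
  apply: contrapT => nex; apply: (nI c); split=> //.
  apply: (Dp_closure_limit p1 (fs_Dp p1 (S := S))
    (w := fun n => g - (ctrunc n.+1%:R^-1 \o g))) => //.
    move=> n; have [phi Iphi phi1] : boundary_filter [set x | cmod (g x) < n.+1%:R^-1].
      by apply: contrapT => nb; apply: nex; exists n.+1%:R^-1 => //; rewrite invr_gt0.
    (* The difference is 0 where [g] is small, and [phi] is 1 elsewhere. *)
    have -> : g - (ctrunc n.+1%:R^-1 \o g) = (g - (ctrunc n.+1%:R^-1 \o g)) * phi.
      apply/funext => x.
      rewrite -[LHS]/(g x - ctrunc n.+1%:R^-1 (g x)).
      rewrite -[RHS]/((g x - ctrunc n.+1%:R^-1 (g x)) * phi x).
      have [gx|gx] := ltP (cmod (g x)) n.+1%:R^-1.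
        by rewrite ctrunc_id ?(ltW gx)// subrr mul0r.
      by rewrite phi1 ?mulr1//=; apply/negP; rewrite -leNgt.
    have Dw := DpD p1 Dg (DpN p1 (Dp_ctrunc p1 n.+1%:R^-1 Dg)).
    have Bw : bounded_function (g - (ctrunc n.+1%:R^-1 \o g)).
      case: Bg => M gM; exists (M + (n.+1%:R^-1 + n.+1%:R^-1)) => x.
      apply: (le_trans (cmodD _ _)); rewrite cmodN; apply: lerD; first exact: gM.
      by apply: ctrunc_bound; rewrite invr_ge0.
    by have [] := null_idealM p1 S_gen Dw Bw Iphi.
  have := vanishing_ctrunc_small p1 Dg.
  by under [X in _ -> vanishing X]eq_fun do rewrite subKr.
pose B := [set x | cmod (g x) < e].
(* The filter generated by [boundary_filter] and the complement of [B]; it is proper because [B] is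
   not in [boundary_filter]. *)
pose F' : set_system G := [set A | boundary_filter (A `|` B)].
have FF' : ProperFilter F'.
  apply: Build_ProperFilter; first by rewrite /F'/= set0U.
  split.
  - by rewrite /F'/= setTU; exact: filterT.
  - by move=> A A' FA FA'; rewrite /F'/= setUIl; exact: filterI.
  - by move=> A A' AA'; rewrite /F'/=; apply: filterS => x [/AA'|]; [left|right].
have [U2 [UU2 FU2]] := @ultraFilterLemma _ F' _.
have FU : boundary_filter `<=` U2.
  by move=> A FA; apply: FU2; apply: filterS FA; exact: subsetUl.
have [tau2 b2 lim2] := ultrafilter_boundary UU2 FU.
exists tau1, tau2; split=> // tau12.
have UB : U2 B by have := lim2 F _ e0; rewrite -tau12.
have UnB : U2 (~` B) by apply: FU2; rewrite /F'/= setvU; exact: filterT.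
by have [x [Bx /(_ Bx)]] := filter_ex (filterI UB UnB).
Qed.

(** Each [f] differs by a constant [c] from a function in the closure of CG, so every boundary point
    sends [f] to [c]. *)
Lemma boundary_points_eq tau1 tau2 : Dp `<=` Dp_closure p S (@lp_plus_constants R p G) ->
  boundary tau1 -> boundary tau2 -> tau1 = tau2.
Proof.
move=> DN b1 b2.
(* Characters are only assumed nonzero; cancelling a nonzero value [tau g] gives unitality. *)
have char1 tau : boundary tau -> tau 1 = 1.
  move=> [[_ tauM [g tg]] _ _]; apply: (mulIf tg).
  by rewrite -tauM !mul1r.
have n1 : ~ Dp_closure p S fs 1.
  move=> cl1; have [_ _ /(_ 1 cl1)] := b1.
  by rewrite /gelfand char1// => /eqP; rewrite oner_eq0.
apply/funext => f.
have /closure_plus_constants[//|//|c clc] : Dp_closure p S (@lp_plus_constants R p G) (val f).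
  by apply: DN; have := valP f; rewrite inE => -[].
suff H tau : boundary tau -> tau f = c by rewrite !H.
move=> bt; have [[tauZ _ _] _ bt0] := bt.
have fc : val (- c *: 1 + f : BD) = val f - cst c.
  by apply/funext => x; rewrite -[LHS]/(- c * 1 + val f x) mulr1 addrC.
have tau0 : tau (- c *: 1 + f) = 0 by apply: bt0; rewrite fc.
have tauE : tau (- c *: 1 + f) = - c * tau 1 + tau f := tauZ (- c) 1 f.
apply/eqP; rewrite -subr_eq0 addrC; apply/eqP.
by rewrite -tau0 tauE (char1 tau bt) mulr1.
Qed.

End BoundaryCharacters.

(** * Counting boundary points, and the equivalence *)

Lemma card_le1P (T : Type) (A : set T) : A #<= `I_1 <-> is_subset1 A.
Proof.
split=> [/pcard_leP/unsquash f x y Ax Ay|A1].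
  apply: ('inj_f); rewrite ?inE//.
  by have := 'funS_f Ax; have := 'funS_f Ay; rewrite /= !ltnS !leqn0 => /eqP -> /eqP ->.
have [[a Aa]|nA] := pselect (A !=set0).
  suff -> : A = [set a] by move: (card_set1 (x := a)); rewrite card_eq_le => /andP[].
  by apply/seteqP; split=> [x Ax|_ ->//]; exact: A1.
suff -> : A = set0 by exact: card_ge0.
by apply/seteqP; split=> // x Ax; apply: nA; exists x.
Qed.

Theorem theorem2p2 (R : realType) (p : R) (p1 : 1 < p)
    (G : groupType) (S : {fset G})
    (S_sym : symmetric_set S) (S_gen : generating_set S)
    (G_inf : infinite_set [set: G]) :
  reduced_H1 p S <> [set reduced_H1_zero p S] <->
  ~~ (harmonic_boundary S p1 #<= `I_1).
Proof.
rewrite (reduced_H1_trivial p1); split=> [nDN|/negP nle DN].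
  (* With at most one boundary point, no bounded [f] can yield two, so each lies in the ideal plus
     the constants. *)
  apply/negP => /card_le1P one; apply: nDN; apply: Dp_sub_closure => // f Df Bf.
  apply: contrapT => nc.
  have [c Ic|t1 [t2 [b1 b2]]] := two_boundary_points p1 S_gen Df Bf.
    by apply: nc; exists c.
  by apply; exact: one.
by apply: nle; apply/card_le1P => t1 t2; exact: boundary_points_eq.
Qed.
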